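(* Let $f:S\to M$ be an umbilical isometric immersion between Riemannian manifolds and let $r$ be the dimension of $S$. If $r\ge 2$, then the following conditions are equivalent: (1) $f$ is special; (2) $f$ is very special; (3) $f$ is an extrinsic sphere.
   Context: $M$ has Levi-Civita connection $\bar\nabla$ and curvature tensor $\bar R(X,Y)=\bar\nabla_X\bar\nabla_Y-\bar\nabla_Y\bar\nabla_X-\bar\nabla_{[X,Y]}$. For an isometric immersion $f:S\to M$ we identify $T_pS$ with its image in the tangent space of $M$, and $(\cdot)^\perp$ denotes orthogonal projection onto the normal space $(T_pS)^\perp$. The second fundamental form is $\alpha(X,Y)=(\bar\nabla_XY)^\perp$, the normal connection is $\nabla^\perp_X\eta=(\bar\nabla_X\eta)^\perp$ for normal fields $\eta$, and the mean curvature vector is $H=\frac1r\sum_{i=1}^r\alpha(X_i,X_i)$ for a local orthonormal frame $(X_i)$ of $S$. The immersion $f$ is umbilical if $\alpha(X,Y)=\langle X,Y\rangle H$ for all $X,Y$ tangent to $S$. It is an extrinsic sphere if it is umbilical and $\nabla^\perp_XH=0$ for all $X$ tangent to $S$. The immersion $f$ is special if for every $p\in S$ and every orthonormal basis $v_1,\dots,v_r$ of $T_pS$ one has $\sum_i\bar R(v_i,w)v_i\in T_pS$ for all $w\in T_pS$. It is very special if for every $p\in S$ and all $v,w\in T_pS$ one has $\bar R(v,w)v\in T_pS$. *)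

(* Defs.v *)
From HB Require Import structures.
From mathcomp Require Import all_boot all_order all_algebra.
From mathcomp Require Import all_classical all_reals all_analysis.
From mathcomp Require Import ring.

Set Implicit Arguments.
Unset Strict Implicit.
Unset Printing Implicit Defensive.

Import Order.TTheory GRing.Theory Num.Theory.
Import numFieldNormedType.Exports.

Local Open Scope classical_set_scope.
Local Open Scope ring_scope.

Section Smooth.
Variables (R : realType) (V W : normedModType R).

Definition iter_derive (s : seq V) (f : V -> W) : V -> W :=
  foldr (fun v (g : V -> W) => 'D_v g) f s.

(* C^oo on an open set U: every iterated directional derivative (including
   f itself, for the empty list) is Frechet differentiable, hence continuous,
   at every point of U. *)
Definition smooth_on (U : set V) (f : V -> W) : Prop :=
  forall (s : seq V) (x : V), U x -> differentiable (iter_derive s f) x.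

End Smooth.

Definition inner (R : realType) (n : nat) (A : 'M[R]_n) (u v : 'rV[R]_n) : R :=
  (u *m A *m v^T) 0 0.

(* A Riemannian metric in one coordinate system is given by its Gram matrix
   field g; vector fields are given by their components. *)
Section LocalRiemannianGeometry.
Variables (R : realType) (n : nat) (g : 'rV[R]_n -> 'M[R]_n).
Implicit Types (x u v w : 'rV[R]_n) (X Y Z : 'rV[R]_n -> 'rV[R]_n).

(* The components of <christoffel x u v, .>, by the Koszul formula for fields
   with constant components (whose brackets vanish). *)
Definition koszul x u v : 'rV[R]_n :=
  \row_l (2^-1 * ('D_u (fun y => inner (g y) v (delta_mx 0 l)) x
                + 'D_v (fun y => inner (g y) u (delta_mx 0 l)) x
                - 'D_(delta_mx 0 l) (fun y => inner (g y) u v) x)).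

(* The vector with components \sum_(a, b) Gamma^k_ab u_a v_b. *)
Definition christoffel x u v : 'rV[R]_n := koszul x u v *m invmx (g x).

(* The Levi-Civita connection; see levi_civita_torsion_free and
   levi_civita_metric below. *)
Definition levi_civita X Y x : 'rV[R]_n :=
  'D_(X x) Y x + christoffel x (X x) (Y x).

Definition lie_bracket X Y x : 'rV[R]_n := 'D_(X x) Y x - 'D_(Y x) X x.

Definition curvature_fields X Y Z x : 'rV[R]_n :=
  levi_civita X (levi_civita Y Z) x - levi_civita Y (levi_civita X Z) x
  - levi_civita (lie_bracket X Y) Z x.

(* The curvature is a tensor, so its value on vectors at x may be computed
   on any fields extending them, here those with constant components. *)
Definition curvature x u v w : 'rV[R]_n :=
  curvature_fields (cst u) (cst v) (cst w) x.

End LocalRiemannianGeometry.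

(* The Levi-Civita axioms for levi_civita, in one coordinate system. *)
Section LeviCivita.
Variables (R : realType) (n : nat) (g : 'rV[R]_n -> 'M[R]_n).
Implicit Types (A : 'M[R]_n) (x u v w : 'rV[R]_n).
Implicit Types X Y Z : 'rV[R]_n -> 'rV[R]_n.

Lemma innerE A u v :
  inner A u v = \sum_(j < n) \sum_(i < n) u 0 i * A i j * v 0 j.
Proof.
rewrite /inner mxE; apply: eq_bigr => j _.
by rewrite !mxE mulr_suml.
Qed.

Lemma innerDl A u u' v : inner A (u + u') v = inner A u v + inner A u' v.
Proof. by rewrite /inner !mulmxDl mxE. Qed.

Lemma innerDr A u v v' : inner A u (v + v') = inner A u v + inner A u v'.
Proof. by rewrite /inner linearD mulmxDr mxE. Qed.

Lemma inner_sym A u v : A^T = A -> inner A u v = inner A v u.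
Proof.
move=> As; rewrite /inner -[in LHS](trmxK (u *m A *m v^T)) mxE.
by rewrite !trmx_mul trmxK As mulmxA.
Qed.

Lemma derive_inner (A : 'rV[R]_n -> 'M[R]_n) Y Z x u :
  derivable A x u -> derivable Y x u -> derivable Z x u ->
  'D_u (fun y => inner (A y) (Y y) (Z y)) x =
  inner ('D_u A x) (Y x) (Z x) + inner (A x) ('D_u Y x) (Z x)
  + inner (A x) (Y x) ('D_u Z x).
Proof.
move=> dA dY dZ.
have -> : (fun y => inner (A y) (Y y) (Z y)) =
  \sum_(j < n) \sum_(i < n)
    ((fun y => Y y 0 i) * (fun y => A y i j) * (fun y => Z y 0 j)).
  apply/funext => y; rewrite innerE fct_sumE; apply: eq_bigr => j _.
  by rewrite fct_sumE.
have dYi i : is_derive x u (fun y => Y y 0 i) ('D_u Y x 0 i).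
  rewrite (derive_mx dY) mxE; apply/derivableP.
  by move/derivable_mxP: dY; apply.
have dZi i : is_derive x u (fun y => Z y 0 i) ('D_u Z x 0 i).
  rewrite (derive_mx dZ) mxE; apply/derivableP.
  by move/derivable_mxP: dZ; apply.
have dAi i j : is_derive x u (fun y => A y i j) ('D_u A x i j).
  rewrite (derive_mx dA) mxE; apply/derivableP.
  by move/derivable_mxP: dA; apply.
rewrite derive_val !innerE -!big_split /=; apply: eq_bigr => j _.
rewrite -!big_split /=; apply: eq_bigr => i _.
rewrite /GRing.scale /= /GRing.mul /=.
change ((Y x 0 i * A x i j) * 'D_u Z x 0 j + Z x 0 j * (Y x 0 i * 'D_u A x i j + A x i j * 'D_u Y x 0 i) =
 Y x 0 i * 'D_u A x i j * Z x 0 j + 'D_u Y x 0 i * A x i j * Z x 0 j +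
  Y x 0 i * A x i j * 'D_u Z x 0 j).
ring.
Qed.

Lemma derive_inner_cst x u v w : derivable g x u ->
  'D_u (fun y => inner (g y) v w) x = inner ('D_u g x) v w.
Proof.
move=> dg; rewrite (@derive_inner g (cst v) (cst w)) //=.
by rewrite !derive_cst /inner trmx0 mulmx0 !mul0mx !mxE !addr0.
Qed.

Lemma inner_christoffel x u v w : g x \in unitmx -> differentiable g x ->
  inner (g x) (christoffel g x u v) w =
  2^-1 * (inner ('D_u g x) v w + inner ('D_v g x) u w - inner ('D_w g x) u v).
Proof.
move=> gU dg; have dgu t : derivable g x t by exact: diff_derivable.
rewrite {1}/inner /christoffel mulmxKV // mxE.
have inner_deltaE A t t' : inner A t t' =
    \sum_(l < n) inner A t (delta_mx 0 l) * t' 0 l.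
  rewrite {1}/inner mxE; apply: eq_bigr => l _.
  by rewrite /inner trmx_delta -colE !mxE.
have -> : inner ('D_w g x) u v =
    \sum_(l < n) inner ('D_(delta_mx 0 l) g x) u v * w 0 l.
  rewrite deriveE // [in X in inner X](row_sum_delta w) linear_sum /=.
  rewrite {1}/inner mulmx_sumr mulmx_suml summxE; apply: eq_bigr => l _.
  by rewrite linearZ /= deriveE // -scalemxAr -scalemxAl mxE mulrC.
rewrite (inner_deltaE _ v w) (inner_deltaE _ u w) -big_split -sumrB mulr_sumr.
apply: eq_bigr => l _.
by rewrite !mxE !derive_inner_cst //=; ring.
Qed.

Lemma levi_civita_torsion_free X Y x : (\forall y \near x, (g y)^T = g y) ->
  levi_civita g X Y x - levi_civita g Y X x = lie_bracket X Y x.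
Proof.
move=> gs; rewrite /levi_civita /lie_bracket.
suff -> : christoffel g x (Y x) (X x) = christoffel g x (X x) (Y x).
  by rewrite opprD addrACA subrr addr0.
rewrite /christoffel; congr (_ *m _); apply/rowP => l; rewrite !mxE.
congr (_ * (_ - _)); first by rewrite addrC.
by apply: near_eq_derive; near=> y; apply: inner_sym; near: y.
Unshelve. all: by end_near. Qed.

Lemma levi_civita_metric X Y Z x :
  (\forall y \near x, (g y)^T = g y) -> g x \in unitmx ->
  differentiable g x -> differentiable Y x -> differentiable Z x ->
  'D_(X x) (fun y => inner (g y) (Y y) (Z y)) x =
  inner (g x) (levi_civita g X Y x) (Z x)
  + inner (g x) (Y x) (levi_civita g X Z x).
Proof.
move=> gs gU dg dY dZ.
rewrite derive_inner; [|exact: diff_derivable..].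
have gx := nbhs_singleton gs.
have Dgs u v w : inner ('D_u g x) v w = inner ('D_u g x) w v.
  rewrite -!derive_inner_cst; [|exact: diff_derivable..].
  by apply: near_eq_derive; near=> y; apply: inner_sym; near: y.
rewrite /levi_civita innerDl innerDr (inner_sym (Y x) (christoffel _ _ _ _)) //.
rewrite !inner_christoffel //.
by rewrite (Dgs (X x) (Z x)); field.
Unshelve. all: by end_near. Qed.

End LeviCivita.

(* A map F between coordinate domains, with metrics gS on the source and gM
   on the target.  The differential of F at x is v |-> v *m jacobian F x, so
   the image of the tangent space is the row space of jacobian F x. *)
Section LocalSubmanifoldGeometry.
Variables (R : realType) (r n : nat).
Variables (gS : 'rV[R]_r -> 'M[R]_r) (gM : 'rV[R]_n -> 'M[R]_n).
Variable F : 'rV[R]_r -> 'rV[R]_n.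
Implicit Types (x u v : 'rV[R]_r) (w : 'rV[R]_n).

Definition push x v : 'rV[R]_n := v *m jacobian F x.

Definition tangent x w : bool := (w <= jacobian F x)%MS.

(* The row space is the set of w with <w, push x v> = 0 for all v. *)
Definition normal_space x : 'M[R]_n :=
  kermx (gM (F x) *m (jacobian F x)^T).

Definition normal_part x w : 'rV[R]_n :=
  w *m proj_mx (normal_space x) <<jacobian F x>>%MS.

(* The connection of the target applied to a vector field V along F. *)
Definition cov_along (V : 'rV[R]_r -> 'rV[R]_n) u x : 'rV[R]_n :=
  'D_u V x + christoffel gM (F x) (push x u) (V x).

Definition normal_connection (eta : 'rV[R]_r -> 'rV[R]_n) u x : 'rV[R]_n :=
  normal_part x (cov_along eta u x).

Definition second_form_fields (X Y : 'rV[R]_r -> 'rV[R]_r) x : 'rV[R]_n :=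
  normal_part x (cov_along (fun y => push y (Y y)) (X x) x).

(* As for the curvature, a tensor evaluated on constant extensions. *)
Definition second_form x u v : 'rV[R]_n :=
  second_form_fields (cst u) (cst v) x.

(* The rows of B are r orthonormal vectors of the r-dimensional tangent
   space, hence a basis. *)
Definition orthonormal_basis x (B : 'M[R]_r) : Prop :=
  B *m gS x *m B^T = 1%:M.

(* The sum does not depend on the orthonormal basis B chosen at x. *)
Definition mean_curvature x : 'rV[R]_n :=
  let B := xget 0 [set B | orthonormal_basis x B] in
  r%:R^-1 *: \sum_(k < r) second_form x (row k B) (row k B).

Definition umbilical_at x : Prop :=
  forall u v, second_form x u v = inner (gS x) u v *: mean_curvature x.

Definition parallel_mean_curvature_at x : Prop :=
  forall u, normal_connection mean_curvature u x = 0.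

Definition special_at x : Prop :=
  forall B, orthonormal_basis x B -> forall u,
  tangent x (\sum_(k < r)
    curvature gM (F x) (push x (row k B)) (push x u) (push x (row k B))).

Definition very_special_at x : Prop :=
  forall u v, tangent x (curvature gM (F x) (push x u) (push x v) (push x u)).

End LocalSubmanifoldGeometry.

(* Smooth n-manifolds without boundary, given by any smooth atlas.  The set
   coord i @` dom i is the range of chart i; outside of dom i and of this
   range, the values of coord i and param i are irrelevant. *)
Record manifold (R : realType) (n : nat) := Manifold {
  point :> topologicalType;
  chart : Type;
  dom : chart -> set point;
  coord : chart -> point -> 'rV[R]_n;
  param : chart -> 'rV[R]_n -> point;
  _ : hausdorff_space point;
  _ : @second_countable point;
  dom_cover : forall p, exists i, dom i p;
  dom_open : forall i, open (dom i);
  range_open : forall i, open (coord i @` dom i);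
  coordK : forall i p, dom i p -> param i (coord i p) = p;
  coord_continuous : forall i, {within dom i, continuous (coord i)};
  param_continuous : forall i,
    {within coord i @` dom i, continuous (param i)};
  transition_smooth : forall i j,
    smooth_on (coord i @` (dom i `&` dom j)) (coord j \o param i)
}.

(* A metric is a family of Gram matrix fields, one for each chart, subject to
   the transformation rule of covariant 2-tensors. *)
Record riemannian_manifold (R : realType) (n : nat) := RiemannianManifold {
  underlying :> manifold R n;
  metric : chart underlying -> 'rV[R]_n -> 'M[R]_n;
  metric_smooth : forall i, smooth_on (coord i @` dom i) (metric i);
  metric_sym : forall i p, dom i p ->
    (metric i (coord i p))^T = metric i (coord i p);
  metric_pos : forall i p, dom i p ->
    forall v, v != 0 -> 0 < inner (metric i (coord i p)) v v;
  metric_transition : forall i j p, dom i p -> dom j p ->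
    let J := jacobian (coord j \o param i) (coord i p) in
    J *m metric j (coord j p) *m J^T = metric i (coord i p)
}.

(* A tangent vector at p is represented by its components in a chart around
   p.  All the conditions below are invariant under changes of charts, and are
   required in all charts around p and f p. *)
Section Immersions.
Variables (R : realType) (r n : nat).
Variables (S : riemannian_manifold R r) (M : riemannian_manifold R n).
Variable f : S -> M.

Definition local_rep (i : chart S) (j : chart M) : 'rV[R]_r -> 'rV[R]_n :=
  coord j \o f \o param i.

Definition local_dom (i : chart S) (j : chart M) : set 'rV[R]_r :=
  coord i @` (dom i `&` f @^-1` dom j).

Definition smooth_map : Prop :=
  continuous f /\ forall i j, smooth_on (local_dom i j) (local_rep i j).

Definition immersion : Prop :=
  smooth_map /\ forall i j x, local_dom i j x ->
    row_free (jacobian (local_rep i j) x).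

Definition isometric_immersion : Prop :=
  immersion /\ forall i j x, local_dom i j x ->
    forall u v, inner (metric j (local_rep i j x))
                  (push (local_rep i j) x u) (push (local_rep i j) x v)
                = inner (metric i x) u v.

Definition umbilical : Prop :=
  forall i j x, local_dom i j x ->
    umbilical_at (metric i) (metric j) (local_rep i j) x.

Definition parallel_mean_curvature : Prop :=
  forall i j x, local_dom i j x ->
    parallel_mean_curvature_at (metric i) (metric j) (local_rep i j) x.

Definition extrinsic_sphere : Prop := umbilical /\ parallel_mean_curvature.

Definition special : Prop :=
  forall i j x, local_dom i j x ->
    special_at (metric i) (metric j) (local_rep i j) x.

Definition very_special : Prop :=
  forall i j x, local_dom i j x ->
    very_special_at (metric j) (local_rep i j) x.

End Immersions.

(* Main.v *)
From mathcomp Require Import all_boot all_order all_algebra.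
From mathcomp Require Import all_classical all_reals all_analysis.
From mathcomp Require Import ring lra.
Require Import Defs.

(** All the conditions are conditions at a point in one pair of charts, so fix
    charts and let F be the local expression of f, J its jacobian, gS and gM
    the two Gram matrix fields.  Write Pu for the field [push F ^~ u] along F,
    D_u for the connection [cov_along], N for [normal_part], H for the mean
    curvature field and D'_u H for its normal derivative.

    The theorem is a consequence of the Codazzi equation of an umbilical
    immersion ([umbilical_codazzi]),

        N (R(Pu, Pv) Pw) = <v, w> D'_u H - <u, w> D'_v H.

    If D' H = 0, its right-hand side vanishes and f is very special
    ([parallel_very_special]).  A very special immersion is special, by adding
    up over an orthonormal basis ([very_special_special]).  If f is special,
    then taking u = w = b_k and summing over an orthonormal basis (b_k) gives
    (1 - r) D'_v H = 0, hence D'_v H = 0 as r >= 2 ([special_parallel]); an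
    orthonormal basis exists by a Cholesky decomposition of gS
    ([exists_orthonormal_rows]).

    The Codazzi equation rests on two computations.  First, the commutator of
    D_u and D_v is the curvature of the target ([curvature_along]); in
    coordinates this uses the symmetry of second derivatives
    ([derive_swap]), the product rule for the bilinear Christoffel symbols
    ([derive_bilinear]) and their symmetry.  Second, umbilicity says that
    D_v Pw = P(t) + <v, w> H, where t is the tangential coordinate vector of
    D_v Pw.  Differentiating along u and taking normal parts, the first
    summand contributes its second fundamental form <u, t> H, so that

        N (D_u D_v Pw) = (<u, t> + u<v, w>) H + <v, w> D'_u H.

    As P is isometric, <u, t> = <Pu, D_v Pw>, and u<v, w> is
    <D_u Pv, Pw> + <Pv, D_u Pw> because the connection is metric.  The
    coefficient of H is therefore symmetric in u and v, since D_u Pv = D_v Pu,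
    and it cancels when the roles of u and v are exchanged and the results are
    subtracted. *)

Set Implicit Arguments.
Unset Strict Implicit.
Unset Printing Implicit Defensive.

Import Order.TTheory GRing.Theory Num.Theory.
Import numFieldNormedType.Exports.

Local Open Scope classical_set_scope.
Local Open Scope ring_scope.

(** * Differential calculus of matrix-valued functions *)

Section Calculus.
Context {R : realType} {V : normedModType R}.

Lemma near_eq_differentiable (W : normedModType R) (f g : V -> W) (x : V) :
  (\forall y \near x, f y = g y) -> differentiable f x -> differentiable g x.
Proof.
move=> fg df; have fx := nbhs_singleton fg.
have gE : g \o shift x = cst (g x) + 'd f x +o_ 0 id.
  apply/eqaddoP => e e0; have /eqaddoP/(_ e e0) := diff_locally df.
  have fg0 : \forall h \near 0, f (h + x) = g (h + x).
    move: fg; rewrite (near_shift 0 x); apply: filterS => h /=.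
    by rewrite subr0.
  apply: filter_app; near=> h.
  have fgh : f (h + x) = g (h + x) by near: h.
  by rewrite !fctE /= fgh fx.
apply/diff_locallyP; rewrite (diff_unique _ gE); last exact: diff_continuous.
by split => //; exact: diff_continuous.
Unshelve. all: by end_near. Qed.

Lemma differentiable_mx m n (M : V -> 'M[R]_(m, n)) x :
  (forall i j, differentiable (fun y => M y i j) x) -> differentiable M x.
Proof.
move=> dM.
have -> : M = \sum_(i < m) \sum_(j < n) (fun y => M y i j *: delta_mx i j).
  apply/funext => y; rewrite fct_sumE [LHS]matrix_sum_delta.
  by apply: eq_bigr => i _; rewrite fct_sumE.
by apply: differentiable_sum => i; apply: differentiable_sum => j;
  exact: differentiableZl.
Qed.

Lemma differentiable_mxE m n (M : V -> 'M[R]_(m, n)) x i j :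
  differentiable M x -> differentiable (fun y => M y i j) x.
Proof.
by move=> dM; exact: (differentiable_comp dM (differentiable_coord _ _ _)).
Qed.

Lemma derive_mxE m n (M : V -> 'M[R]_(m, n)) x v i j :
  derivable M x v -> 'D_v M x i j = 'D_v (fun y => M y i j) x.
Proof. by move=> dM; rewrite (derive_mx dM) mxE. Qed.

Lemma differentiable_trmx m n (A : V -> 'M[R]_(m, n)) x :
  differentiable A x -> differentiable (fun y => (A y)^T) x.
Proof.
move=> dA; apply: differentiable_mx => i j.
apply: (@near_eq_differentiable _ (fun y => A y j i)).
  by near=> y; rewrite mxE.
exact: differentiable_mxE.
Unshelve. all: by end_near. Qed.

Lemma derive_trmx m n (A : V -> 'M[R]_(m, n)) x u : differentiable A x ->
  'D_u (fun y => (A y)^T) x = ('D_u A x)^T.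
Proof.
move=> dA; apply/matrixP => i j; rewrite mxE.
apply: (eq_trans (derive_mxE i j (diff_derivable (differentiable_trmx dA)))).
apply: (eq_trans _ (esym (derive_mxE j i (diff_derivable dA)))).
by apply: near_eq_derive; near=> y; rewrite mxE.
Unshelve. all: by end_near. Qed.

Lemma differentiable_mulmx m n p (A : V -> 'M[R]_(m, n)) (B : V -> 'M[R]_(n, p))
    x : differentiable A x -> differentiable B x ->
  differentiable (fun y => A y *m B y) x.
Proof.
move=> dA dB; apply: differentiable_mx => i j.
have -> : (fun y => (A y *m B y) i j) =
    \sum_(k < n) ((fun y => A y i k) * (fun y => B y k j)).
  by apply/funext => y; rewrite fct_sumE mxE.
by apply: differentiable_sum => k; apply: differentiableM;
  exact: differentiable_mxE.
Qed.

Lemma derive_mulmx m n p (A : V -> 'M[R]_(m, n)) (B : V -> 'M[R]_(n, p)) x u :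
  differentiable A x -> differentiable B x ->
  'D_u (fun y => A y *m B y) x = 'D_u A x *m B x + A x *m 'D_u B x.
Proof.
move=> dA dB; apply/matrixP => i j.
rewrite derive_mxE; last exact/diff_derivable/differentiable_mulmx.
have -> : (fun y => (A y *m B y) i j) =
    \sum_(k < n) ((fun y => A y i k) * (fun y => B y k j)).
  by apply/funext => y; rewrite fct_sumE mxE.
have dAE k : derivable (fun y => A y i k) x u.
  exact/diff_derivable/differentiable_mxE.
have dBE k : derivable (fun y => B y k j) x u.
  exact/diff_derivable/differentiable_mxE.
rewrite derive_sum => [|k]; last exact: derivableM.
rewrite !mxE -big_split /=; apply: eq_bigr => k _.
rewrite deriveM // !derive_mxE; [|exact: diff_derivable..].
by rewrite addrC; congr (_ + _); exact: mulrC.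
Qed.

Lemma differentiable_mulmxr m n p (A : V -> 'M[R]_(m, n)) (C : 'M[R]_(n, p)) x :
  differentiable A x -> differentiable (fun y => A y *m C) x.
Proof. by move=> dA; apply: (@differentiable_mulmx _ _ _ A (cst C)). Qed.

Lemma derive_mulmxr m n p (A : V -> 'M[R]_(m, n)) (C : 'M[R]_(n, p)) x u :
  differentiable A x -> 'D_u (fun y => A y *m C) x = 'D_u A x *m C.
Proof.
move=> dA; rewrite (@derive_mulmx _ _ _ A (cst C)) // derive_cst mulmx0.
by rewrite addr0.
Qed.

Lemma derive_mulmxl m n p (C : 'M[R]_(m, n)) (A : V -> 'M[R]_(n, p)) x u :
  differentiable A x -> 'D_u (fun y => C *m A y) x = C *m 'D_u A x.
Proof.
move=> dA; rewrite (@derive_mulmx _ _ _ (cst C) A) // derive_cst mul0mx.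
by rewrite add0r.
Qed.

Lemma differentiable_scale m n (k : V -> R) (A : V -> 'M[R]_(m, n)) x :
  differentiable k x -> differentiable A x ->
  differentiable (fun y => k y *: A y) x.
Proof.
move=> dk dA; apply: differentiable_mx => i j.
apply: (@near_eq_differentiable _ (k * (fun y => A y i j))).
  by near=> y; rewrite mxE.
by apply: differentiableM => //; exact: differentiable_mxE.
Unshelve. all: by end_near. Qed.

Lemma derive_scale m n (k : V -> R) (A : V -> 'M[R]_(m, n)) x u :
  differentiable k x -> differentiable A x ->
  'D_u (fun y => k y *: A y) x = 'D_u k x *: A x + k x *: 'D_u A x.
Proof.
move=> dk dA; apply/matrixP => i j; rewrite !mxE.
have dkA := diff_derivable (v := u) (differentiable_scale dk dA).
apply: (eq_trans (derive_mxE i j dkA)).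
have dAij := diff_derivable (v := u) (differentiable_mxE i j dA).
rewrite (derive_mxE i j (diff_derivable dA)).
rewrite (_ : (fun y => _) = k * (fun y => A y i j)); last first.
  by apply/funext => y; rewrite mxE.
rewrite (deriveM (diff_derivable dk) dAij) addrC.
by congr (_ + _); exact: mulrC.
Qed.

Lemma differentiable_prod (I : Type) (s : seq I) (f : I -> V -> R) x :
  (forall i, differentiable (f i) x) ->
  differentiable (fun y => \prod_(i <- s) f i y) x.
Proof.
move=> df; elim: s => [|i s IH].
  rewrite (_ : (fun _ => _) = cst 1); first exact: differentiable_cst.
  by apply/funext => y; rewrite big_nil.
rewrite (_ : (fun _ => _) = f i * (fun y => \prod_(j <- s) f j y)).
  exact: differentiableM.
by apply/funext => y; rewrite big_cons.
Qed.

Lemma differentiable_bigsum (W : normedModType R) (I : Type) (s : seq I)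
    (f : I -> V -> W) x :
  (forall i, differentiable (f i) x) ->
  differentiable (fun y => \sum_(i <- s) f i y) x.
Proof.
move=> df; elim: s => [|i s IH].
  rewrite (_ : (fun _ => _) = cst 0); first exact: differentiable_cst.
  by apply/funext => y; rewrite big_nil.
rewrite (_ : (fun _ => _) = f i + (fun y => \sum_(j <- s) f j y)).
  exact: differentiableD.
by apply/funext => y; rewrite big_cons.
Qed.

Lemma differentiable_det n (A : V -> 'M[R]_n) x :
  differentiable A x -> differentiable (fun y => \det (A y)) x.
Proof.
move=> dA; apply: differentiable_bigsum => s.
apply: (@differentiableM _ _ (cst ((-1) ^+ _))) => //.
by apply: differentiable_prod => k; exact: differentiable_mxE.
Qed.

(** Cramer's rule: the entries of the inverse are quotients of polynomials in
    the entries of the matrix. *)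
Lemma differentiable_invmx n (A : V -> 'M[R]_n) x :
  differentiable A x -> (\forall y \near x, A y \in unitmx) ->
  differentiable (fun y => invmx (A y)) x.
Proof.
move=> dA Au.
have dcof i j : differentiable (fun y => cofactor (A y) i j) x.
  rewrite /cofactor.
  rewrite (_ : (fun _ => _) = cst ((-1) ^+ (i + j)) *
     (fun y => \det (row' i (col' j (A y))))) //.
  apply: differentiableM => //; apply: differentiable_det.
  apply: differentiable_mx => k l.
  rewrite (_ : (fun _ => _) = (fun y => A y (lift i k) (lift j l))).
    exact: differentiable_mxE.
  by apply/funext => y; rewrite !mxE.
apply: (@near_eq_differentiable _
    (fun y => \matrix_(i, j) ((\det (A y))^-1 * cofactor (A y) j i))).
  near=> y; rewrite /invmx ifT; last by near: y.
  by apply/matrixP => i j; rewrite !mxE.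
apply: differentiable_mx => i j.
rewrite (_ : (fun _ => _) = (fun y => (\det (A y))^-1) *
   (fun y => cofactor (A y) j i)); last by apply/funext => y; rewrite mxE.
apply: differentiableM => //; apply: differentiableV.
  exact: differentiable_det.
by have := nbhs_singleton Au; rewrite unitmxE unitfE.
Unshelve. all: by end_near. Qed.

End Calculus.

(** * Symmetry of second derivatives *)

Section Schwarz.
Context {R : realType} {V : normedModType R}.

Lemma is_derive_affine (f : V -> R) (p u : V) (s : R) :
  differentiable f (s *: u + p) ->
  is_derive s 1 (fun h : R => f (h *: u + p)) ('D_u f (s *: u + p)).
Proof.
move=> df.
have dl : is_diff s (fun h : R => h *: u + p) ( *:%R ^~ u).
  have := is_diffD (is_diff_scalel s u) (is_diff_cst p s).
  by rewrite addr0.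
have dfl : differentiable (f \o (fun h : R => h *: u + p)) s.
  exact: differentiable_comp.
apply: DeriveDef; first exact: diff_derivable.
by rewrite deriveE // diff_comp //= diff_val scale1r deriveE.
Qed.

(** The mean value theorem, applied to s |-> f (x + s u + t v) - f (x + s u) on
    [0, t], turns the second difference into t times an increment of 'D_u f in
    the direction t v, which the differential of 'D_u f at x computes up to
    o(t). *)
Lemma second_difference (f : V -> R) (x u v : V) (e : R) : 0 < e ->
  (\forall y \near x, differentiable f y) -> differentiable ('D_u f) x ->
  \forall t \near 0^'+,
   `|f (t *: u + (t *: v + x)) - f (t *: u + x) - f (t *: v + x) + f x
     - t ^+ 2 * 'D_v ('D_u f) x| <= e * t ^+ 2.
Proof.
move=> e0 df ddf.
pose g : V -> R := 'D_u f.
(* Both points at which 'D_u f is expanded lie within t * (`|u| + `|v|) of x,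
   so that the two error terms add up to at most e * t. *)
pose c := 2 * (`|u| + `|v|) + 1.
have c0 : 0 < c by rewrite ltr_wpDl // mulr_ge0 // addr_ge0.
have /eqaddoP/(_ (e / c) (divr_gt0 e0 c0)) := diff_locally ddf.
rewrite -/g => /nbhs_normP[d1 /= d10 gd].
have /nbhs_normP[d2 /= d20 fd] := df.
near=> t.
have t0 : 0 < t by [].
have tc1 : t * c < d1.
  by rewrite -ltr_pdivlMr //; near: t; apply: nbhs_right_lt; rewrite divr_gt0.
have tc2 : t * c < d2.
  by rewrite -ltr_pdivlMr //; near: t; apply: nbhs_right_lt; rewrite divr_gt0.
have small (s : R) (y : V) : s \in `[0, t]%R -> `|y| <= t * `|v| ->
    `|s *: u + y| <= t * (`|u| + `|v|).
  rewrite in_itv /= => /andP[s0 st] hy.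
  rewrite (le_trans (ler_normD _ _)) // mulrDr lerD // normrZ ger0_norm //.
  by rewrite ler_wpM2r.
have hv : `|t *: v| <= t * `|v| by rewrite normrZ gtr0_norm.
have h0 : `|0 : V| <= t * `|v| by rewrite normr0 mulr_ge0 // ltW.
have leC (y : V) : `|y| <= t * (`|u| + `|v|) -> `|y| < t * c.
  move=> /le_lt_trans; apply; rewrite ltr_pM2l // /c.
  by have := normr_ge0 u; have := normr_ge0 v; lra.
have dfs (s : R) (y : V) : s \in `[0, t]%R -> `|y| <= t * `|v| ->
    differentiable f (s *: u + (y + x)).
  move=> st hy; apply: fd; rewrite /= addrA opprD addrCA subrr addr0 normrN.
  by rewrite (lt_trans (leC _ (small _ _ st hy))).
have gs (s : R) (y : V) : s \in `[0, t]%R -> `|y| <= t * `|v| ->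
    `|g (s *: u + (y + x)) - g x - 'd g x (s *: u + y)| <=
    e / c * (t * (`|u| + `|v|)).
  move=> st hy; have := gd (s *: u + y).
  rewrite /= sub0r normrN => /(_ (lt_trans (leC _ (small _ _ st hy)) tc1)).
  rewrite !fctE /= opprD addrA addrA => /le_trans; apply.
  by rewrite ler_wpM2l ?small // divr_ge0 // ltW.
pose k (s : R) : R := f (s *: u + (t *: v + x)) - f (s *: u + x).
pose dk (s : R) : R := g (s *: u + (t *: v + x)) - g (s *: u + x).
have dkP (s : R) : s \in `[0, t]%R -> is_derive s 1 k (dk s).
  move=> st; apply: is_deriveB; apply: is_derive_affine; first exact: dfs.
  by have := dfs s 0 st h0; rewrite add0r.
have tt0 : 0 <= t by exact: ltW.
have mv := @MVT_segment R k dk 0 t tt0.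
have kc : {within `[0, t], continuous k}.
  by apply: derivable_within_continuous => s st; have [] := dkP s st.
have kd s : s \in `]0, t[%R -> is_derive s 1 k (dk s).
  by move=> /subset_itv_oo_cc; exact: dkP.
have [s st kE] := mv kd kc.
have -> : f (t *: u + (t *: v + x)) - f (t *: u + x) - f (t *: v + x) + f x =
    k t - k 0.
  by rewrite /k !scale0r !add0r; ring.
rewrite kE subr0 mulrC expr2 -mulrA -mulrBr normrM gtr0_norm //.
rewrite mulrCA ler_pM2l //.
have -> : dk s - t * 'D_v g x =
    (g (s *: u + (t *: v + x)) - g x - 'd g x (s *: u + t *: v)) -
    (g (s *: u + x) - g x - 'd g x (s *: u)).
  by rewrite /dk deriveE // !linearD !linearZ /= /GRing.scale /=; ring.
have g2 := gs s 0 st h0; rewrite add0r addr0 in g2.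
rewrite (le_trans (ler_normB _ _)) //.
rewrite (le_trans (lerD (gs _ _ st hv) g2)) //.
rewrite -(ler_pM2r c0).
have -> : (e / c * (t * (`|u| + `|v|)) + e / c * (t * (`|u| + `|v|))) * c =
    e * t * (2 * (`|u| + `|v|)) by field; rewrite gt_eqF.
by rewrite ler_pM2l ?mulr_gt0 // /c lerDl.
Unshelve. all: by end_near. Qed.

Lemma norm_quotient_le (t e p A B : R) : 0 < t ->
  `|p - t ^+ 2 * A| <= e / 2 * t ^+ 2 ->
  `|p - t ^+ 2 * B| <= e / 2 * t ^+ 2 -> `|A - B| <= e.
Proof.
move=> t0; rewrite ler_norml => hA; rewrite ler_norml => hB.
suff : `|t ^+ 2 * (A - B)| <= t ^+ 2 * e.
  by rewrite normrM (ger0_norm (sqr_ge0 t)) ler_pM2l ?exprn_gt0.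
by rewrite ler_norml mulrBr; lra.
Qed.

(** The second difference of f in the directions u and v is symmetric in u and
    v, and it approximates t ^+ 2 times each of the two mixed derivatives. *)
Lemma derive_swap_scalar (f : V -> R) (x u v : V) :
  (\forall y \near x, differentiable f y) ->
  differentiable ('D_u f) x -> differentiable ('D_v f) x ->
  'D_u ('D_v f) x = 'D_v ('D_u f) x.
Proof.
move=> df du dv; apply/eqP; rewrite -subr_eq0 -normr_le0.
apply/ler_addgt0Pr => e e0; rewrite add0r.
have e20 : 0 < e / 2 by rewrite divr_gt0.
have H1 := @second_difference f x u v _ e20 df du.
have H2 := @second_difference f x v u _ e20 df dv.
have [t [[h2 h1] t0]] := filter_ex (filterI (filterI H1 H2) (nbhs_right_gt (0 : R))).
apply: (norm_quotient_le t0 h1); apply: le_trans h2.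
by rewrite [t *: u + (t *: v + x)]addrCA (addrAC (f _)).
Qed.

End Schwarz.

Section MatrixCalculus.
Context {R : realType} {V : normedModType R}.

Lemma derive_swap m n (M : V -> 'M[R]_(m, n)) x u v :
  (\forall y \near x, differentiable M y) ->
  differentiable ('D_u M) x -> differentiable ('D_v M) x ->
  'D_u ('D_v M) x = 'D_v ('D_u M) x.
Proof.
move=> dM du dv.
have DE w i j : \forall y \near x, 'D_w M y i j = 'D_w (fun z => M z i j) y.
  by near=> y; apply: derive_mxE; apply: diff_derivable; near: y.
apply/matrixP => i j.
have dv' : derivable ('D_v M) x u by exact: (diff_derivable dv).
have du' : derivable ('D_u M) x v by exact: (diff_derivable du).
apply: (eq_trans (derive_mxE i j dv')).
apply: (eq_trans (near_eq_derive u (DE v i j))).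
apply/esym.
apply: (eq_trans (derive_mxE i j du')).
apply: (eq_trans (near_eq_derive v (DE u i j))).
apply/esym.
apply: derive_swap_scalar.
- by apply: filterS dM => y dM; exact: differentiable_mxE.
- exact: near_eq_differentiable (DE u i j) (differentiable_mxE _ _ du).
- exact: near_eq_differentiable (DE v i j) (differentiable_mxE _ _ dv).
Unshelve. all: by end_near. Qed.

(** * Product rule for a variable bilinear map *)

Section BilinearProductRule.
Variables p q m : nat.
Implicit Type B : 'rV[R]_p -> 'rV[R]_q -> 'rV[R]_m.

(** Christoffel symbols are bilinear only at the points of the chart, which is
    why bilinearity is a predicate on functions here, not a structure. *)
Definition bilinear_rV B :=
  (forall a a' c b, B (c *: a + a') b = c *: B a b + B a' b) /\
  (forall a b b' c, B a (c *: b + b') = c *: B a b + B a b').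

Lemma bilinear_rV0l B b : bilinear_rV B -> B 0 b = 0.
Proof.
move=> [Bl _]; have := Bl 0 0 1 b; rewrite !scale1r addr0 => h.
by apply: (addrI (B 0 b)); rewrite addr0 -h.
Qed.

Lemma bilinear_rV0r B a : bilinear_rV B -> B a 0 = 0.
Proof.
move=> [_ Br]; have := Br a 0 0 1; rewrite !scale1r addr0 => h.
by apply: (addrI (B a 0)); rewrite addr0 -h.
Qed.

(** In this form a bilinear map is built from matrix products only, with
    coefficient matrices depending on B alone; the product rule for matrix
    products then yields the one for a variable B. *)
Lemma bilinear_rVE B : bilinear_rV B -> forall a b,
  B a b = \sum_l (b *m delta_mx l 0) *m
            (a *m \matrix_(k, j) B (delta_mx 0 k) (delta_mx 0 l) 0 j).
Proof.
move=> Bbil a b; have [Bl Br] := Bbil.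
have -> : B a b = \sum_l b 0 l *: B a (delta_mx 0 l).
  rewrite {1}(row_sum_delta b); elim/big_rec2: _ => [|l y z _ <-].
    exact: bilinear_rV0r.
  by rewrite Br.
apply: eq_bigr => l _.
have -> : b *m delta_mx l 0 = (b 0 l)%:M.
  by rewrite -colE; apply/matrixP => i j; rewrite !ord1 !mxE eqxx.
rewrite mul_scalar_mx; congr (_ *: _).
have -> : B a (delta_mx 0 l) = \sum_k a 0 k *: B (delta_mx 0 k) (delta_mx 0 l).
  rewrite {1}(row_sum_delta a); elim/big_rec2: _ => [|k y z _ <-].
    exact: bilinear_rV0l.
  by rewrite Bl.
apply/rowP => j; rewrite summxE mxE; apply: eq_bigr => k _.
by rewrite !mxE.
Qed.

Variables (B : V -> 'rV[R]_p -> 'rV[R]_q -> 'rV[R]_m).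
Variables (a : V -> 'rV[R]_p) (b : V -> 'rV[R]_q) (x : V).
Hypothesis Bbil : \forall y \near x, bilinear_rV (B y).
Hypothesis dB : forall k l,
  differentiable (fun y => B y (delta_mx 0 k) (delta_mx 0 l)) x.
Hypotheses (da : differentiable a x) (db : differentiable b x).

Let C l y : 'M[R]_(p, m) :=
  \matrix_(k, j) B y (delta_mx 0 k) (delta_mx 0 l) 0 j.

Let dC l : differentiable (C l) x.
Proof.
apply: differentiable_mx => k j.
rewrite (_ : (fun _ => _) =
    (fun y => B y (delta_mx 0 k) (delta_mx 0 l) 0 j)).
  exact: differentiable_mxE.
by apply/funext => y; rewrite mxE.
Qed.

Let dterm (a' : V -> 'rV[R]_p) (b' : V -> 'rV[R]_q) l :
  differentiable a' x -> differentiable b' x ->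
  differentiable (fun y => (b' y *m delta_mx l (0 : 'I_1)) *m (a' y *m C l y)) x.
Proof.
move=> da' db'; apply: differentiable_mulmx; last exact: differentiable_mulmx.
exact: differentiable_mulmxr.
Qed.

Lemma differentiable_bilinear : differentiable (fun y => B y (a y) (b y)) x.
Proof.
apply: (@near_eq_differentiable _ _ _
   (fun y => \sum_l (b y *m delta_mx l (0 : 'I_1)) *m (a y *m C l y))).
  by apply: filterS Bbil => y By; rewrite (bilinear_rVE By).
by apply: differentiable_bigsum => l; exact: dterm.
Qed.

Lemma derive_bilinear u :
  'D_u (fun y => B y (a y) (b y)) x =
  'D_u (fun y => B y (a x) (b x)) x
  + B x ('D_u a x) (b x) + B x (a x) ('D_u b x).
Proof.
have key (a' : V -> 'rV[R]_p) (b' : V -> 'rV[R]_q) :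
    differentiable a' x -> differentiable b' x ->
    'D_u (fun y => B y (a' y) (b' y)) x =
    \sum_l (b' x *m delta_mx l (0 : 'I_1)) *m (a' x *m 'D_u (C l) x)
    + B x ('D_u a' x) (b' x) + B x (a' x) ('D_u b' x).
  move=> da' db'.
  rewrite (@near_eq_derive _ _ _ _
    (\sum_l (fun y => (b' y *m delta_mx l (0 : 'I_1)) *m (a' y *m C l y)))).
    rewrite derive_sum => [|l]; last exact/diff_derivable/dterm.
    rewrite !(bilinear_rVE (nbhs_singleton Bbil)) -!big_split /=.
    apply: eq_bigr => l _.
    rewrite derive_mulmx; [|exact: differentiable_mulmxr|
                           exact: differentiable_mulmx].
    rewrite derive_mulmxr // derive_mulmx // mulmxDr -/(C l x) [LHS]addrC.
    by congr (_ + _); rewrite addrC.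
  by apply: filterS Bbil => y By; rewrite (bilinear_rVE By) fct_sumE.
have Bx := nbhs_singleton Bbil.
rewrite key // (key (cst (a x)) (cst (b x))) // !derive_cst.
by rewrite (bilinear_rV0l _ Bx) (bilinear_rV0r _ Bx) !addr0.
Qed.

End BilinearProductRule.
End MatrixCalculus.

(** * Inner products and Christoffel symbols *)

Section Inner.
Context {R : realType} {n : nat}.
Implicit Types (A : 'M[R]_n) (u v w : 'rV[R]_n).

Lemma innerPl A c u u' v : inner A (c *: u + u') v = c * inner A u v + inner A u' v.
Proof. by rewrite innerDl /inner -!scalemxAl mxE. Qed.

Lemma innerPr A c u v v' : inner A u (c *: v + v') = c * inner A u v + inner A u v'.
Proof. by rewrite innerDr /inner linearZ -scalemxAr mxE. Qed.

Lemma innerPmx A A' c u v : inner (c *: A + A') u v = c * inner A u v + inner A' u v.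
Proof. by rewrite /inner mulmxDr mulmxDl -scalemxAr -scalemxAl !mxE. Qed.

Lemma inner_ext A A' : (forall u v, inner A u v = inner A' u v) -> A = A'.
Proof.
move=> AA'; apply/matrixP => i j; have := AA' (delta_mx 0 i) (delta_mx 0 j).
by rewrite /inner -!rowE trmx_delta -!colE !mxE.
Qed.

Lemma posdef_unitmx A : (forall v, v != 0 -> 0 < inner A v v) -> A \in unitmx.
Proof.
move=> Apos; rewrite -row_free_unit -kermx_eq0; apply/rowV0P => v /sub_kermxP vA.
apply/eqP; apply: contraT => /Apos.
by rewrite /inner vA mul0mx mxE ltxx.
Qed.

(** The Koszul formula as an algebraic operation on the derivative D of the
    metric. *)
Definition koszul_row (D : 'rV[R]_n -> 'M[R]_n) u v : 'rV[R]_n :=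
  \row_l (2^-1 * (inner (D u) v (delta_mx 0 l) + inner (D v) u (delta_mx 0 l)
                  - inner (D (delta_mx 0 l)) u v)).

Lemma koszul_row_bilinear (D : 'rV[R]_n -> 'M[R]_n) :
  (forall c w w', D (c *: w + w') = c *: D w + D w') ->
  bilinear_rV (koszul_row D).
Proof.
move=> Dl; split=> [u u' c v|u v v' c]; apply/rowP => l; rewrite !mxE Dl innerPmx.
  by rewrite !innerPl; ring.
by rewrite innerPr innerPl; ring.
Qed.

Lemma differentiable_inner (V : normedModType R) (A : V -> 'M[R]_n)
    (Y Z : V -> 'rV[R]_n) x :
  differentiable A x -> differentiable Y x -> differentiable Z x ->
  differentiable (fun y => inner (A y) (Y y) (Z y)) x.
Proof.
move=> dA dY dZ; apply: differentiable_mxE.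
apply: differentiable_mulmx; first exact: differentiable_mulmx.
exact: differentiable_trmx.
Qed.

(** The fields may be defined on any normed space, in particular on the source
    of a map, where they are fields along that map. *)
Lemma derive_inner_diff (V : normedModType R) (A : V -> 'M[R]_n)
    (Y Z : V -> 'rV[R]_n) x (u : V) :
  differentiable A x -> differentiable Y x -> differentiable Z x ->
  'D_u (fun y => inner (A y) (Y y) (Z y)) x =
  inner ('D_u A x) (Y x) (Z x) + inner (A x) ('D_u Y x) (Z x)
  + inner (A x) (Y x) ('D_u Z x).
Proof.
move=> dA dY dZ; have dYA := differentiable_mulmx dY dA.
have dZt := differentiable_trmx dZ.
have dYAZ := diff_derivable (v := u) (differentiable_mulmx dYA dZt).
rewrite -[LHS](derive_mxE 0 0 dYAZ).
rewrite (derive_mulmx u dYA dZt) (derive_mulmx u dY dA) (derive_trmx u dZ).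
rewrite mulmxDl [LHS]mxE [X in X + _]mxE.
by congr (_ + _); exact: addrC.
Qed.

End Inner.

Section Christoffel.
Context {R : realType} {n : nat}.
Variables (O : set 'rV[R]_n) (g : 'rV[R]_n -> 'M[R]_n).
Hypotheses (oO : open O) (gsm : smooth_on O g).
Hypothesis gsym : forall y, O y -> (g y)^T = g y.
Hypothesis gpos : forall y, O y -> forall v, v != 0 -> 0 < inner (g y) v v.
Implicit Types (y u v w : 'rV[R]_n).

Let near_O y : O y -> \forall z \near y, O z.
Proof. by move=> Oy; apply: open_nbhs_nbhs. Qed.

Let dg y : O y -> differentiable g y.
Proof. by move=> Oy; exact: (gsm [::] Oy). Qed.

Let ddg y u : O y -> differentiable ('D_u g) y.
Proof. by move=> Oy; exact: (gsm [:: u] Oy). Qed.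

Lemma koszulE y u v l : O y -> koszul g y u v 0 l =
  2^-1 * (inner ('D_u g y) v (delta_mx 0 l) + inner ('D_v g y) u (delta_mx 0 l)
          - inner ('D_(delta_mx 0 l) g y) u v).
Proof.
move=> Oy; rewrite mxE (derive_inner_cst v); last exact/diff_derivable/dg.
rewrite (derive_inner_cst u); last exact/diff_derivable/dg.
by rewrite (derive_inner_cst u); last exact/diff_derivable/dg.
Qed.

Let deriveP y c u u' : O y -> 'D_(c *: u + u') g y = c *: 'D_u g y + 'D_u' g y.
Proof. by move=> Oy; rewrite !deriveE ?linearP //; exact: dg. Qed.

Lemma koszul_bilinear y : O y -> bilinear_rV (koszul g y).
Proof.
move=> Oy; have -> : koszul g y = koszul_row (fun w => 'D_w g y).
  by apply/funext => u; apply/funext => v; apply/rowP => l; rewrite koszulE // mxE.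
by apply: koszul_row_bilinear => c w w'; exact: deriveP.
Qed.

Lemma christoffel_bilinear y : O y -> bilinear_rV (christoffel g y).
Proof.
move=> /koszul_bilinear [kl kr]; rewrite /christoffel.
by split=> [u u' c v|u v v' c]; rewrite scalemxAl -mulmxDl (kl, kr).
Qed.

Lemma differentiable_christoffel y u v :
  O y -> differentiable (fun z => christoffel g z u v) y.
Proof.
move=> Oy; apply: differentiable_mulmx; last first.
  apply: differentiable_invmx; first exact: dg.
  by apply: filterS (near_O Oy) => z Oz; exact/posdef_unitmx/gpos.
apply: differentiable_mx => i l; rewrite ord1.
pose e : 'rV[R]_n := delta_mx 0 l.
apply: (@near_eq_differentiable _ _ _ (cst 2^-1 *
  ((fun z => inner ('D_u g z) v e) + (fun z => inner ('D_v g z) u e) -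
   (fun z => inner ('D_e g z) u v)))).
  by apply: filterS (near_O Oy) => z Oz; rewrite koszulE.
have dI w a b : differentiable (fun z => inner ('D_w g z) a b) y.
  apply: (@differentiable_inner _ _ _ _ (cst a) (cst b)) => //; exact: ddg.
apply: differentiableM => //; apply: differentiableB => //.
exact: differentiableD.
Qed.

(** This is the vanishing of the torsion for fields with constant components,
    whose bracket is zero. *)
Lemma christoffel_sym y u v : O y -> christoffel g y u v = christoffel g y v u.
Proof.
move=> Oy; have gs : \forall z \near y, (g z)^T = g z.
  by apply: filterS (near_O Oy) => z; exact: gsym.
have := levi_civita_torsion_free (cst u) (cst v) gs.
rewrite /levi_civita /lie_bracket !derive_cst subrr !add0r.
by move/eqP; rewrite subr_eq0 => /eqP.
Qed.

(** On fields with constant components the connection reduces to the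
    Christoffel symbols, and the bracket term disappears. *)
Lemma curvatureE y u v w : O y -> curvature g y u v w =
  'D_u (fun z => christoffel g z v w) y
  + christoffel g y u (christoffel g y v w)
  - ('D_v (fun z => christoffel g z u w) y
     + christoffel g y v (christoffel g y u w)).
Proof.
move=> Oy.
have lcE a b : levi_civita g (cst a) (cst b) = fun z => christoffel g z a b.
  by apply/funext => z; rewrite /levi_civita derive_cst add0r.
rewrite /curvature /curvature_fields !lcE.
rewrite [X in _ - X](_ : _ = 0); last first.
  rewrite /levi_civita /lie_bracket !derive_cst subrr add0r.
  exact/bilinear_rV0l/christoffel_bilinear.
by rewrite subr0.
Qed.

(** This is the compatibility of the connection with the metric, for fields
    with constant components. *)
Lemma metric_christoffel y u v w : O y -> inner ('D_u g y) v w =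
  inner (g y) (christoffel g y u v) w + inner (g y) v (christoffel g y u w).
Proof.
move=> Oy; have gs : \forall z \near y, (g z)^T = g z.
  by apply: filterS (near_O Oy) => z; exact: gsym.
have := levi_civita_metric (cst u) gs (posdef_unitmx (gpos Oy)) (dg Oy)
  (differentiable_cst v y) (differentiable_cst w y).
rewrite derive_inner_cst; last exact/diff_derivable/dg.
by rewrite /levi_civita !derive_cst !add0r.
Qed.

End Christoffel.

(** * Covariant differentiation along a map *)

Section AlongMap.
Context {R : realType} {r n : nat}.
Variables (U : set 'rV[R]_r) (O : set 'rV[R]_n).
Variables (gM : 'rV[R]_n -> 'M[R]_n) (F : 'rV[R]_r -> 'rV[R]_n).
Hypotheses (oU : open U) (oO : open O) (FO : forall x, U x -> O (F x)).
Hypotheses (Fsm : smooth_on U F) (gsm : smooth_on O gM).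
Hypothesis gsym : forall y, O y -> (gM y)^T = gM y.
Hypothesis gpos : forall y, O y -> forall v, v != 0 -> 0 < inner (gM y) v v.
Implicit Types (x u v w : 'rV[R]_r).

Lemma near_domain x : U x -> \forall y \near x, U y.
Proof. by move=> Ux; apply: open_nbhs_nbhs. Qed.

Lemma pushE x v : U x -> push F x v = 'D_v F x.
Proof. by move=> Ux; rewrite deriveEjacobian //; exact: (Fsm [::] Ux). Qed.

Lemma differentiable_push x v : U x -> differentiable (fun y => push F y v) x.
Proof.
move=> Ux; apply: near_eq_differentiable (Fsm [:: v] Ux).
by apply: filterS (near_domain Ux) => y Uy; rewrite pushE.
Qed.

Lemma derive_push x u v : U x -> 'D_u (fun y => push F y v) x = 'D_u ('D_v F) x.
Proof.
move=> Ux; apply: near_eq_derive.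
by apply: filterS (near_domain Ux) => y Uy; rewrite pushE.
Qed.

(** Both sides are second derivatives of F. *)
Lemma derive_push_sym x u v : U x ->
  'D_u (fun y => push F y v) x = 'D_v (fun y => push F y u) x.
Proof.
move=> Ux; apply: (eq_trans (derive_push u v Ux)).
apply: (eq_trans _ (esym (derive_push v u Ux))); apply: derive_swap.
- by apply: filterS (near_domain Ux) => y; exact: (Fsm [::]).
- exact: (Fsm [:: u] Ux).
- exact: (Fsm [:: v] Ux).
Qed.

Lemma derive_comp_push (W : normedModType R) (G : 'rV[R]_n -> W) x u : U x ->
  differentiable G (F x) -> 'D_u (G \o F) x = 'D_(push F x u) G (F x).
Proof.
move=> Ux dG; have dF : differentiable F x := Fsm [::] Ux.
have dGF : differentiable (G \o F) x by exact: differentiable_comp.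
apply: (eq_trans (deriveE u dGF)).
apply: (eq_trans _ (esym (deriveE (push F x u) dG))).
by rewrite diff_comp // /= pushE // (deriveE u dF).
Qed.

Lemma differentiable_jacobian x : U x -> differentiable (jacobian F) x.
Proof.
move=> Ux; apply: differentiable_mx => i j.
apply: (@near_eq_differentiable _ _ _ (fun y => push F y (delta_mx 0 i) 0 j)).
  by near=> y; rewrite /push -rowE mxE.
exact/differentiable_mxE/differentiable_push.
Unshelve. all: by end_near.
Qed.

Lemma differentiable_metric_comp x : U x -> differentiable (gM \o F) x.
Proof.
move=> Ux; apply: differentiable_comp; first exact: (Fsm [::] Ux).
exact: (gsm [::] (FO Ux)).
Qed.

Let chr x := christoffel gM (F x).

Let chr_bil x : U x -> bilinear_rV (chr x).
Proof. by move=> /FO; exact: christoffel_bilinear. Qed.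

Let dchr x a b : U x -> differentiable (fun y => chr y a b) x.
Proof.
move=> Ux; apply: (@differentiable_comp _ _ _ _ F (fun z => christoffel gM z a b)).
  exact: (Fsm [::] Ux).
exact: (differentiable_christoffel oO gsm gpos _ _ (FO Ux)).
Qed.

Let near_chr_bil x : U x -> \forall y \near x, bilinear_rV (chr y).
Proof. by move=> Ux; apply: filterS (near_domain Ux) => y; exact: chr_bil. Qed.

Implicit Types (X Y Z : 'rV[R]_r -> 'rV[R]_n).

Lemma eq_cov_along X Y u x : (forall y, U y -> X y = Y y) -> U x ->
  cov_along gM F X u x = cov_along gM F Y u x.
Proof.
move=> XY Ux; rewrite /cov_along XY //; congr (_ + _).
by apply: near_eq_derive; apply: filterS (near_domain Ux).
Qed.

Lemma differentiable_cov_along X u x : U x -> differentiable X x ->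
  differentiable ('D_u X) x -> differentiable (cov_along gM F X u) x.
Proof.
move=> Ux dX ddX.
apply: (@differentiableD _ _ _ ('D_u X) (fun y => chr y (push F y u) (X y))) => //.
apply: differentiable_bilinear => //; first exact: near_chr_bil.
  by move=> k l; exact: dchr.
exact: differentiable_push.
Qed.

Lemma cov_alongD X Y u x : U x -> differentiable X x -> differentiable Y x ->
  cov_along gM F (fun y => X y + Y y) u x =
  cov_along gM F X u x + cov_along gM F Y u x.
Proof.
move=> Ux dX dY; rewrite /cov_along.
rewrite (deriveD (diff_derivable dX) (diff_derivable dY)).
have [_ Gr] := chr_bil Ux.
by have := Gr (push F x u) (X x) (Y x) 1; rewrite !scale1r /chr => ->; rewrite addrACA.
Qed.

Lemma cov_along_push_sym u v x : U x ->
  cov_along gM F (fun y => push F y v) u x =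
  cov_along gM F (fun y => push F y u) v x.
Proof.
move=> Ux; exact: (congr2 +%R (derive_push_sym u v Ux)
  (christoffel_sym oO gsym (push F x u) (push F x v) (FO Ux))).
Qed.

Lemma derive_inner_along X Y u x : U x ->
  differentiable X x -> differentiable Y x ->
  'D_u (fun y => inner (gM (F y)) (X y) (Y y)) x =
  inner (gM (F x)) (cov_along gM F X u x) (Y x) +
  inner (gM (F x)) (X x) (cov_along gM F Y u x).
Proof.
move=> Ux dX dY.
apply: (eq_trans (derive_inner_diff u (differentiable_metric_comp Ux) dX dY)).
have -> : 'D_u (gM \o F) x = 'D_(push F x u) gM (F x).
  exact: (derive_comp_push u Ux (gsm [::] (FO Ux))).
rewrite (metric_christoffel oO gsm gsym gpos _ _ _ (FO Ux)).
rewrite /cov_along innerDl innerDr -addrA addrACA.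
by congr (_ + _); exact: addrC.
Qed.

Let reorder (W : zmodType) (a b c d e t : W) :
  a + (t + b + e) + (c + d) = a + b + (e + c) + (t + d).
Proof.
rewrite -!addrA; congr (_ + _); rewrite addrCA; congr (_ + _).
by rewrite addrCA; congr (_ + _); rewrite addrCA.
Qed.

(** The terms are grouped so that the first two summands, and the sum of the
    next two, are symmetric in u and v; the last group, minus the same with u
    and v exchanged, is the coordinate expression of the curvature. *)
Lemma cov_along_cov_along X u v x : U x -> (forall y, U y -> differentiable X y) ->
  differentiable ('D_v X) x ->
  cov_along gM F (cov_along gM F X v) u x =
    'D_u ('D_v X) x + chr x ('D_u (fun y => push F y v) x) (X x)
    + (chr x (push F x v) ('D_u X x) + chr x (push F x u) ('D_v X x))
    + ('D_(push F x u) (fun z => christoffel gM z (push F x v) (X x)) (F x)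
       + chr x (push F x u) (chr x (push F x v) (X x))).
Proof.
move=> Ux dX ddX.
have dX' := dX _ Ux; have dP := differentiable_push v Ux.
have dGX : differentiable (fun y => chr y (push F y v) (X y)) x.
  apply: differentiable_bilinear => //; first exact: near_chr_bil.
  by move=> k l; exact: dchr.
have DE : 'D_u (cov_along gM F X v) x =
    'D_u ('D_v X) x + 'D_u (fun y => chr y (push F y v) (X y)) x.
  exact: (deriveD (diff_derivable ddX) (diff_derivable dGX)).
rewrite {1}/cov_along DE.
rewrite (derive_bilinear (near_chr_bil Ux)) //; last by move=> k l; exact: dchr.
have -> : 'D_u (fun y => chr y (push F x v) (X x)) x =
    'D_(push F x u) (fun z => christoffel gM z (push F x v) (X x)) (F x).
  apply: (@derive_comp_push _ (fun z => christoffel gM z (push F x v) (X x))) => //.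
  exact: (differentiable_christoffel oO gsm gpos _ _ (FO Ux)).
have -> : christoffel gM (F x) (push F x u) (cov_along gM F X v x) =
    chr x (push F x u) ('D_v X x) + chr x (push F x u) (chr x (push F x v) (X x)).
  have [_ Gr] := chr_bil Ux.
  have := Gr (push F x u) ('D_v X x) (chr x (push F x v) (X x)) 1.
  by rewrite !scale1r.
exact: reorder.
Qed.

Let sub_sym_part (W : zmodType) (s s' a a' b b' c c' p q : W) :
  s = a + b + (p + q) + c -> s' = a' + b' + (q + p) + c' -> a = a' -> b = b' ->
  s - s' = c - c'.
Proof. by move=> -> -> -> ->; rewrite (addrC q) opprD addrACA subrr add0r. Qed.

Lemma curvature_along X u v x : U x -> (forall y, U y -> differentiable X y) ->
  differentiable ('D_u X) x -> differentiable ('D_v X) x ->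
  cov_along gM F (cov_along gM F X v) u x -
  cov_along gM F (cov_along gM F X u) v x =
  curvature gM (F x) (push F x u) (push F x v) (X x).
Proof.
move=> Ux dX dXu dXv.
apply: (eq_trans _ (esym (curvatureE gsm _ _ _ (FO Ux)))).
apply: (sub_sym_part (cov_along_cov_along u Ux dX dXv)
                     (cov_along_cov_along v Ux dX dXu)).
  apply: (derive_swap _ dXu dXv).
  by apply: filterS (near_domain Ux) => y; exact: dX.
exact: (congr1 (fun a => chr x a (X x)) (derive_push_sym u v Ux)).
Qed.

End AlongMap.

(** * Existence of orthonormal bases *)

(** Cholesky decomposition: clear the first row and column of A by the
    unipotent matrix L, rescale the positive corner a to 1, and recurse on the
    Schur complement S, which is positive definite because it is a restriction
    of the form A. *)
Lemma exists_orthonormal_rows (R : rcfType) n (A : 'M[R]_n) : A^T = A ->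
  (forall v : 'rV_n, v != 0 -> 0 < (v *m A *m v^T) 0 0) ->
  exists B : 'M[R]_n, B *m A *m B^T = 1%:M.
Proof.
elim: n A => [|n IH] A As Apos; first by exists 0; rewrite [LHS]flatmx0 [RHS]flatmx0.
pose A' : 'M[R]_(1 + n) := A.
pose a := A 0 0; pose c : 'rV[R]_n := ursubmx A'; pose d : 'M[R]_n := drsubmx A'.
have AE : A' = block_mx a%:M c c^T d.
  rewrite -[LHS]submxK; congr block_mx.
  - by rewrite [LHS]mx11_scalar !mxE lshift0.
  - by rewrite -[A' in LHS]As trmx_ursub.
have a0 : 0 < a.
  have := Apos (delta_mx 0 0); rewrite -rowE trmx_delta -colE !mxE; apply.
  by apply/eqP => /rowP/(_ 0)/eqP; rewrite !mxE !eqxx oner_eq0.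
pose L : 'M[R]_(1 + n) := block_mx 1%:M 0 (- a^-1 *: c^T) 1%:M.
pose S := d - a^-1 *: (c^T *m c).
have LAL : L *m A' *m L^T = block_mx a%:M 0 0 S.
  rewrite AE /L tr_block_mx !mulmx_block !mul1mx !mul0mx !addr0 !trmx1 !trmx0.
  rewrite !mulmx1 !mulmx0 !addr0 linearZ /= trmxK.
  rewrite mul_mx_scalar -scalemxAl scalerA mulrN divff ?gt_eqF // scaleN1r.
  rewrite addNr mul0mx add0r !mul_scalar_mx scalerA mulrN divff ?gt_eqF //.
  by rewrite scaleN1r addNr addrC scaleNr.
have Ss : S^T = S.
  have ds : d^T = d by rewrite /d trmx_drsub /A' As.
  by rewrite /S linearB /= linearZ /= trmx_mul trmxK ds.
have Spos (v : 'rV[R]_n) : v != 0 -> 0 < (v *m S *m v^T) 0 0.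
  move=> v0; pose w : 'rV[R]_(1 + n) := row_mx 0 v *m L.
  have -> : v *m S *m v^T = w *m A' *m w^T.
    have -> : w *m A' *m w^T = row_mx 0 v *m (L *m A' *m L^T) *m (row_mx 0 v)^T.
      by rewrite trmx_mul !mulmxA.
    rewrite LAL mul_row_block tr_row_mx mul_row_col !mul0mx !mulmx0 trmx0.
    by rewrite mulmx0 !add0r.
  apply: Apos; apply: contra_neq v0 => w0.
  have : rsubmx w = 0 by rewrite w0 linear0.
  by rewrite /w /L mul_row_block row_mxKr mul0mx mulmx1 add0r.
have [B' BS] := IH S Ss Spos.
pose D : 'M[R]_(1 + n) := block_mx (Num.sqrt a)^-1%:M 0 0 B'.
exists (D *m L : 'M[R]_(1 + n)).
have -> : (D *m L) *m A' *m (D *m L)^T = D *m (L *m A' *m L^T) *m D^T.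
  by rewrite trmx_mul !mulmxA.
rewrite LAL /D tr_block_mx !mulmx_block !mul0mx !mulmx0 !trmx0 !mulmx0.
rewrite !addr0 !add0r mul0mx BS tr_scalar_mx -!scalar_mxM.
rewrite -{2}(sqr_sqrtr (ltW a0)).
have -> : (Num.sqrt a)^-1 * Num.sqrt a ^+ 2 * (Num.sqrt a)^-1 = 1.
  by field; rewrite gt_eqF // sqrtr_gt0.
by rewrite mul0mx -scalar_mx_block.
Qed.

(** * Tangential and normal parts *)

Section Codazzi.
Context {R : realType} {r n : nat}.
Variables (U : set 'rV[R]_r) (O : set 'rV[R]_n).
Variables (gS : 'rV[R]_r -> 'M[R]_r) (gM : 'rV[R]_n -> 'M[R]_n).
Variable (F : 'rV[R]_r -> 'rV[R]_n).
Hypotheses (oU : open U) (oO : open O) (FO : forall x, U x -> O (F x)).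
Hypotheses (Fsm : smooth_on U F) (gsm : smooth_on O gM).
Hypothesis gsym : forall y, O y -> (gM y)^T = gM y.
Hypothesis gpos : forall y, O y -> forall v, v != 0 -> 0 < inner (gM y) v v.
Hypothesis gSpos : forall x, U x -> forall v, v != 0 -> 0 < inner (gS x) v v.
Hypothesis Fiso : forall x, U x -> forall u v,
  inner (gM (F x)) (push F x u) (push F x v) = inner (gS x) u v.
Implicit Types (x u v : 'rV[R]_r) (w : 'rV[R]_n).

Let J := jacobian F.

Lemma induced_metricE x : U x -> J x *m gM (F x) *m (J x)^T = gS x.
Proof.
move=> Ux; apply: inner_ext => u v; rewrite -Fiso // /inner /push.
by rewrite trmx_mul !mulmxA.
Qed.

(** The orthogonal projection of w to the tangent space is
    [push F x (w *m tangential_coord x)]: these are the normal equations of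
    least squares. *)
Definition tangential_coord x : 'M[R]_(n, r) :=
  gM (F x) *m (J x)^T *m invmx (gS x).

Let gS_unit x : U x -> gS x \in unitmx.
Proof. by move=> Ux; exact/posdef_unitmx/gSpos. Qed.

Lemma push_tangential_coord x v : U x -> push F x v *m tangential_coord x = v.
Proof.
move=> Ux; rewrite /push /tangential_coord !mulmxA -/J.
by rewrite -(mulmxA v) -(mulmxA v) induced_metricE // mulmxK // gS_unit.
Qed.

Lemma normal_partE x w : U x ->
  normal_part gM F x w = w - push F x (w *m tangential_coord x).
Proof.
move=> Ux; rewrite /normal_part.
set a := push F x _; set N := normal_space gM F x.
have aJ : (a <= <<J x>>)%MS by rewrite genmxE submxMl.
have wN : (w - a <= N)%MS.
  apply/sub_kermxP; rewrite mulmxBl /a /push -/J.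
  rewrite -[X in _ - X]mulmxA (mulmxA (J x)) induced_metricE //.
  by rewrite /tangential_coord !mulmxA mulmxKV ?gS_unit // subrr.
have NJ0 : (N :&: <<J x>>)%MS = 0.
  apply/eqP/rowV0P => b; rewrite sub_capmx genmxE => /andP[/sub_kermxP bN].
  move=> /submxP[c bE]; rewrite bE in bN *.
  suff -> : c = 0 by rewrite mul0mx.
  by rewrite -(push_tangential_coord c Ux) /push /tangential_coord mulmxA bN mul0mx.
rewrite -[X in X *m _](subrK a w) mulmxDl (proj_mx_id NJ0 wN).
by rewrite (proj_mx_0 NJ0 aJ) addr0.
Qed.

Lemma normal_partD x w w' :
  normal_part gM F x (w + w') = normal_part gM F x w + normal_part gM F x w'.
Proof. exact: mulmxDl. Qed.

Lemma normal_partB x w w' :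
  normal_part gM F x (w - w') = normal_part gM F x w - normal_part gM F x w'.
Proof. exact: mulmxBl. Qed.

Lemma normal_partZ x c w : normal_part gM F x (c *: w) = c *: normal_part gM F x w.
Proof. by rewrite /normal_part -scalemxAl. Qed.

Lemma normal_part_push x v : U x -> normal_part gM F x (push F x v) = 0.
Proof. by move=> Ux; rewrite normal_partE // push_tangential_coord // subrr. Qed.

Lemma normal_part_id x w : U x ->
  normal_part gM F x (normal_part gM F x w) = normal_part gM F x w.
Proof.
move=> Ux; rewrite [in LHS](normal_partE w Ux) normal_partB normal_part_push //.
by rewrite subr0.
Qed.

Lemma tangentE x w : U x -> tangent F x w = (normal_part gM F x w == 0).
Proof.
move=> Ux; apply/idP/eqP => [/submxP[v ->]|]; first exact: normal_part_push.
by rewrite normal_partE // => /eqP; rewrite subr_eq0 => /eqP ->; exact: submxMl.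
Qed.

Lemma inner_tangential_coord x u w : U x ->
  inner (gS x) u (w *m tangential_coord x) = inner (gM (F x)) (push F x u) w.
Proof.
move=> Ux; have gFs := gsym (FO Ux).
have gSs : (gS x)^T = gS x.
  by rewrite -induced_metricE // !trmx_mul trmxK gFs mulmxA.
rewrite (inner_sym _ _ gSs) (inner_sym _ _ gFs) /inner /push /tangential_coord.
by rewrite trmx_mul !mulmxA mulmxKV // gS_unit.
Qed.

Lemma differentiable_induced_metric x : U x -> differentiable gS x.
Proof.
move=> Ux; have dJ := differentiable_jacobian oU Fsm Ux.
have dg := differentiable_metric_comp FO Fsm gsm Ux.
have dJg := differentiable_mulmx dJ dg.
apply: near_eq_differentiable (differentiable_mulmx dJg (differentiable_trmx dJ)).
by apply: filterS (near_domain oU Ux) => y Uy; rewrite induced_metricE.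
Qed.

Lemma differentiable_tangential_coord x : U x -> differentiable tangential_coord x.
Proof.
move=> Ux; have dJ := differentiable_jacobian oU Fsm Ux.
have dg := differentiable_metric_comp FO Fsm gsm Ux.
have dgJ := differentiable_mulmx dg (differentiable_trmx dJ).
apply: (differentiable_mulmx dgJ); apply: differentiable_invmx.
  exact: differentiable_induced_metric.
by apply: filterS (near_domain oU Ux) => y; exact: gS_unit.
Qed.

Implicit Types X : 'rV[R]_r -> 'rV[R]_n.

Lemma cov_alongZ (k : 'rV[R]_r -> R) X u x : U x ->
  differentiable k x -> differentiable X x ->
  cov_along gM F (fun y => k y *: X y) u x =
  'D_u k x *: X x + k x *: cov_along gM F X u x.
Proof.
move=> Ux dk dX; rewrite /cov_along (derive_scale u dk dX) scalerDr addrA.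
congr (_ + _); have Gbil := christoffel_bilinear gsm (FO Ux); have [_ Gr] := Gbil.
have := Gr (push F x u) (X x) 0 (k x).
by rewrite !addr0 (bilinear_rV0r _ Gbil) addr0.
Qed.

(** The derivative of the coefficients t only produces tangent vectors, so t
    may be frozen at x. *)
Lemma normal_part_cov_push (t : 'rV[R]_r -> 'rV[R]_r) u x : U x ->
  differentiable t x ->
  normal_part gM F x (cov_along gM F (fun y => push F y (t y)) u x) =
  second_form gM F x u (t x).
Proof.
move=> Ux dt; have dJ := differentiable_jacobian oU Fsm Ux.
rewrite /second_form /second_form_fields /cov_along /=.
have -> : 'D_u (fun y => push F y (t y)) x =
    push F x ('D_u t x) + t x *m 'D_u (jacobian F) x.
  exact: (derive_mulmx u dt dJ).
have -> : 'D_u (fun y => push F y (cst (t x) y)) x = t x *m 'D_u (jacobian F) x.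
  exact: (derive_mulmxl (t x) u dJ).
by rewrite -addrA normal_partD normal_part_push // add0r.
Qed.

(** * The Codazzi equation of an umbilical immersion *)

Variable H : 'rV[R]_r -> 'rV[R]_n.
Hypothesis r_gt0 : (0 < r)%N.
Hypothesis umb : forall x, U x -> forall u v,
  second_form gM F x u v = inner (gS x) u v *: H x.

Let W (w v : 'rV[R]_r) := cov_along gM F (fun y => push F y w) v.

Let dW (w v : 'rV[R]_r) x : U x -> differentiable (W w v) x.
Proof.
move=> Ux; apply: (differentiable_cov_along oU oO FO Fsm gsm gpos Ux).
  exact: (differentiable_push oU Fsm _ Ux).
apply: near_eq_differentiable (Fsm [:: v; w] Ux).
apply: filterS (near_domain oU Ux) => y Uy /=.
exact: (esym (derive_push oU Fsm v w Uy)).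
Qed.

Let normal_W (w v : 'rV[R]_r) x : U x ->
  normal_part gM F x (W w v x) = inner (gS x) v w *: H x.
Proof. by move=> Ux; rewrite -umb. Qed.

Let e : 'rV[R]_r := delta_mx 0 (Ordinal r_gt0).

Let gS_basis_gt0 x : U x -> 0 < inner (gS x) e e.
Proof.
move=> Ux; apply: gSpos => //; apply/negP => /eqP/rowP/(_ (Ordinal r_gt0)).
by rewrite !mxE !eqxx => /eqP; rewrite oner_eq0.
Qed.

(** Evaluating umbilicity on a fixed vector e exhibits H as a quotient of
    differentiable fields, which is how its differentiability is obtained. *)
Lemma umbilical_mean_curvatureE x : U x ->
  H x = (inner (gS x) e e)^-1 *: normal_part gM F x (W e e x).
Proof.
move=> Ux; rewrite normal_W // scalerA mulVf ?scale1r //.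
by rewrite gt_eqF // gS_basis_gt0.
Qed.

Lemma normal_mean_curvature x : U x -> normal_part gM F x (H x) = H x.
Proof.
move=> Ux; rewrite [in LHS](umbilical_mean_curvatureE Ux) normal_partZ.
by rewrite normal_part_id // -umbilical_mean_curvatureE.
Qed.

Lemma differentiable_mean_curvature x : U x -> differentiable H x.
Proof.
move=> Ux.
have dgS := differentiable_induced_metric Ux.
have dT := differentiable_tangential_coord Ux.
have dJ := differentiable_jacobian oU Fsm Ux.
apply: (@near_eq_differentiable _ _ _ (fun y => (inner (gS y) e e)^-1 *:
    (W e e y - W e e y *m tangential_coord y *m jacobian F y))).
  apply: filterS (near_domain oU Ux) => y Uy.
  by rewrite (umbilical_mean_curvatureE Uy) normal_partE.
apply: differentiable_scale.
  apply: differentiableV; last by rewrite gt_eqF // gS_basis_gt0.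
  exact: (@differentiable_inner _ _ _ _ (cst e) (cst e)).
apply: differentiableB; first exact: dW.
by apply: differentiable_mulmx => //; apply: differentiable_mulmx => //; exact: dW.
Qed.

(* This is the formula for N (D_u D_v Pw): the first summand of the coefficient
   of H is <u, t>, the other two are the derivative of <v, w>. *)
Let normal_cov_W (w u v : 'rV[R]_r) x : U x ->
  normal_part gM F x (cov_along gM F (W w v) u x) =
  (inner (gM (F x)) (push F x u) (W w v x)
   + (inner (gM (F x)) (W v u x) (push F x w)
      + inner (gM (F x)) (push F x v) (W w u x))) *: H x
  + inner (gS x) v w *: normal_connection gM F H u x.
Proof.
move=> Ux.
pose t y := W w v y *m tangential_coord y.
pose s y := inner (gS y) v w.
have dt : differentiable t x.
  by apply: differentiable_mulmx; [exact: dW|exact: differentiable_tangential_coord].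
have ds : differentiable s x.
  apply: (@differentiable_inner _ _ _ _ (cst v) (cst w)) => //.
  exact: differentiable_induced_metric.
have dH := differentiable_mean_curvature Ux.
have dJ := differentiable_jacobian oU Fsm Ux.
have WE y : U y -> W w v y = push F y (t y) + s y *: H y.
  by move=> Uy; rewrite -normal_W // normal_partE // addrC subrK.
rewrite (eq_cov_along gM F oU u WE Ux).
rewrite (cov_alongD FO gsm u Ux (differentiable_mulmx dt dJ) (differentiable_scale ds dH)).
rewrite cov_alongZ // normal_partD (normal_partD _ (_ *: _)) !normal_partZ.
rewrite normal_part_cov_push //
  umb // normal_mean_curvature // addrA -scalerDl inner_tangential_coord //.
congr ((_ + _) *: _ + _).
have -> : 'D_u s x = 'D_u (fun y => inner (gM (F y)) (push F y v) (push F y w)) x.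
  by apply: near_eq_derive; apply: filterS (near_domain oU Ux) => y Uy; rewrite Fiso.
apply: (derive_inner_along oO FO Fsm gsm gsym gpos u Ux);
  exact: (differentiable_push oU Fsm _ Ux).
Qed.

Let sub_sym_coef (a b b' c : R) (h p q m m' : 'rV[R]_n) :
  m = (a + (b + c)) *: h + p -> m' = (c + (b' + a)) *: h + q -> b = b' ->
  m - m' = p - q.
Proof.
move=> -> -> ->; have -> : c + (b' + a) = a + (b' + c) by ring.
by rewrite opprD addrACA subrr add0r.
Qed.

(** The curvature is the commutator of the covariant derivatives of Pw, and in
    the difference of the two normal parts the multiples of H cancel by the
    symmetry of D_u Pv. *)
Lemma umbilical_codazzi x u v (w : 'rV[R]_r) : U x ->
  normal_part gM F x
    (curvature gM (F x) (push F x u) (push F x v) (push F x w)) =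
  inner (gS x) v w *: normal_connection gM F H u x
  - inner (gS x) u w *: normal_connection gM F H v x.
Proof.
move=> Ux.
have dP y : U y -> differentiable (fun z => push F z w) y.
  by move=> Uy; exact: (differentiable_push oU Fsm _ Uy).
have ddP a : differentiable ('D_a (fun z => push F z w)) x.
  apply: near_eq_differentiable (Fsm [:: a; w] Ux).
  apply: filterS (near_domain oU Ux) => y Uy /=.
  exact: (esym (derive_push oU Fsm a w Uy)).
rewrite -(curvature_along oU oO FO Fsm gsm gpos Ux dP (ddP u) (ddP v)).
apply: (eq_trans (normal_partB x _ _)).
apply: (sub_sym_coef (normal_cov_W w u v Ux) (normal_cov_W w v u Ux)).
apply: (congr1 (fun z => inner (gM (F x)) z (push F x w))).
exact: (cov_along_push_sym oU oO FO Fsm gsym u v Ux).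
Qed.

Local Notation N x u := (normal_connection gM F H u x).

Let NP x c u u' : U x -> N x (c *: u + u') = c *: N x u + N x u'.
Proof.
move=> Ux; have dH := differentiable_mean_curvature Ux.
have [Gl _] := christoffel_bilinear gsm (FO Ux).
rewrite /normal_connection -normal_partZ -normal_partD; congr (normal_part _ _ _ _).
rewrite /cov_along !(deriveE _ dH) linearP.
have -> : push F x (c *: u + u') = c *: push F x u + push F x u'.
  by rewrite /push mulmxDl -scalemxAl.
by rewrite Gl scalerDr addrACA.
Qed.

Lemma parallel_very_special x : U x -> (forall u, N x u = 0) ->
  very_special_at gM F x.
Proof.
move=> Ux N0 u v; rewrite tangentE // umbilical_codazzi //.
by rewrite !N0 !scaler0 subrr.
Qed.

(** In the trace of the Codazzi equation over the rows b_k of B, the sum of the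
    <u, b_k> D'_(b_k) H is D'_u H, and the other sum is r D'_u H. *)
Lemma special_parallel x (B : 'M[R]_r) : U x -> (1 < r)%N ->
  orthonormal_basis gS x B -> special_at gS gM F x -> forall u, N x u = 0.
Proof.
move=> Ux r_gt1 Bo sp u.
have normal_sum (I : Type) (s : seq I) (f : I -> 'rV[R]_n) :
    normal_part gM F x (\sum_(i <- s) f i) = \sum_(i <- s) normal_part gM F x (f i).
  by rewrite /normal_part mulmx_suml.
have NZ c v : N x (c *: v) = c *: N x v.
  have N0 : N x 0 = 0.
    have := NP 1 0 0 Ux; rewrite !scale1r addr0 => h.
    by apply: (addrI (N x 0)); rewrite addr0 -h.
  by have := NP c v 0 Ux; rewrite N0 !addr0.
have N_sum (I : Type) (s : seq I) (c : I -> R) (v : I -> 'rV[R]_r) :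
    N x (\sum_(i <- s) c i *: v i) = \sum_(i <- s) c i *: N x (v i).
  elim: s => [|i s IH]; last by rewrite !big_cons NP // IH.
  by rewrite !big_nil; have := NZ 0 0; rewrite !scale0r.
have uE : \sum_k inner (gS x) u (row k B) *: row k B = u.
  have BB : (gS x *m B^T) *m B = 1%:M.
    by apply: mulmx1C; rewrite mulmxA.
  rewrite -[RHS]mulmx1 -BB !mulmxA [RHS]mulmx_sum_row; apply: eq_bigr => k _.
  by congr (_ *: _); rewrite /inner tr_row colE mulmxA -colE mxE.
have b1 k : inner (gS x) (row k B) (row k B) = 1.
  have Bkk : (B *m gS x *m B^T) k k = 1 by rewrite Bo mxE eqxx.
  rewrite -[RHS]Bkk /inner -row_mul tr_row colE mulmxA -colE -row_mul.
  by rewrite [LHS]mxE mxE.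
have := sp B Bo u; rewrite tangentE // normal_sum.
under eq_bigr do rewrite umbilical_codazzi // b1 scale1r.
rewrite sumrB -N_sum uE sumr_const card_ord -scaler_nat -[X in X - _]scale1r.
rewrite -scalerBl scaler_eq0 subr_eq0 => /orP[|/eqP//].
by rewrite eq_sym pnatr_eq1 => /eqP r1; rewrite r1 in r_gt1.
Qed.

End Codazzi.

Lemma very_special_special (R : realType) (r n : nat)
    (gS : 'rV[R]_r -> 'M[R]_r) (gM : 'rV[R]_n -> 'M[R]_n)
    (F : 'rV[R]_r -> 'rV[R]_n) x :
  very_special_at gM F x -> special_at gS gM F x.
Proof. by move=> vs B _ u; apply: summx_sub => k _; exact: vs. Qed.

(** * From charts to manifolds *)

Section Charts.
Context {R : realType} {r n : nat}.
Variables (S : riemannian_manifold R r) (M : riemannian_manifold R n).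
Variable f : S -> M.

(** The parametrization is continuous on the open range of the chart, so the
    chart maps open sets to open sets. *)
Lemma open_local_dom (i : chart S) (j : chart M) :
  continuous f -> open (local_dom f i j).
Proof.
move=> fc; rewrite openE => _ [p [ip jp] <-].
have ipR : (coord i @` dom i) (coord i p) by exists p.
have pc : {for coord i p, continuous (param i)}.
  have := @param_continuous _ _ S i.
  rewrite continuous_open_subspace; last exact: range_open.
  by apply; rewrite inE.
have fpc : {for coord i p, continuous (f \o param i)}.
  by apply: continuous_comp => //; exact: fc.
have nj : nbhs ((f \o param i) (coord i p)) (dom j).
  by rewrite /= coordK //; apply: open_nbhs_nbhs; split => //; exact: dom_open.
have nR := open_nbhs_nbhs (conj (@range_open _ _ S i) ipR).
have {}fpc : \forall y \near coord i p, dom j (f (param i y)) := fpc _ nj.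
rewrite /interior /=; apply: filterS2 nR fpc => _ [q iq <-].
by rewrite coordK // => jq; exists q.
Qed.

Hypotheses (f_iso : isometric_immersion f) (f_umb : umbilical f).
Hypothesis r_ge2 : (1 < r)%N.
Variables (i : chart S) (j : chart M).

Let U := local_dom f i j.
Let O := coord j @` dom j.
Let F := local_rep f i j.

Let oU : open U.
Proof. by apply: open_local_dom; case: f_iso => [[[]]]. Qed.

Let oO : open O. Proof. exact: range_open. Qed.

Let FO x : U x -> O (F x).
Proof. by move=> [p [ip jp] <-]; exists (f p) => //; rewrite /F /local_rep /= coordK. Qed.

Let Fsm : smooth_on U F.
Proof. by case: f_iso => [[[_ sm] _] _]; exact: sm. Qed.

Let gsm : smooth_on O (metric j). Proof. exact: metric_smooth. Qed.

Let gsym y : O y -> (metric j y)^T = metric j y.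
Proof. by move=> [p jp <-]; exact: metric_sym. Qed.

Let gpos y : O y -> forall v, v != 0 -> 0 < inner (metric j y) v v.
Proof. by move=> [p jp <-]; exact: metric_pos. Qed.

Let gSpos x : U x -> forall v, v != 0 -> 0 < inner (metric i x) v v.
Proof. by move=> [p [ip jp] <-]; exact: metric_pos. Qed.

Let Fiso x : U x -> forall u v,
  inner (metric j (F x)) (push F x u) (push F x v) = inner (metric i x) u v.
Proof. by case: f_iso => _ h Ux; exact: h. Qed.

Let umb x : U x -> forall u v, second_form (metric j) F x u v =
  inner (metric i x) u v *: mean_curvature (metric i) (metric j) F x.
Proof. by move=> Ux; exact: f_umb. Qed.

Lemma local_parallel_very_special x : local_dom f i j x ->
  parallel_mean_curvature_at (metric i) (metric j) (local_rep f i j) x ->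
  very_special_at (metric j) (local_rep f i j) x.
Proof.
exact: (parallel_very_special oU oO FO Fsm gsm gsym gpos gSpos Fiso (ltnW r_ge2) umb).
Qed.

Lemma local_special_parallel x : local_dom f i j x ->
  special_at (metric i) (metric j) (local_rep f i j) x ->
  parallel_mean_curvature_at (metric i) (metric j) (local_rep f i j) x.
Proof.
move=> Ux sp; have [p [ip jp] pE] := Ux.
have gs : (metric i x)^T = metric i x by rewrite -pE; exact: metric_sym.
have [B BE] := exists_orthonormal_rows gs (gSpos Ux).
exact: (special_parallel oU oO FO Fsm gsm gsym gpos gSpos Fiso (ltnW r_ge2) umb
  Ux r_ge2 BE sp).
Qed.

End Charts.

Theorem proposition3p1 (R : realType) (r n : nat)
    (S : riemannian_manifold R r) (M : riemannian_manifold R n)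
    (f : S -> M) (f_iso : isometric_immersion f) (f_umb : umbilical f)
    (r_ge2 : (2 <= r)%N) :
  (special f <-> very_special f) /\ (very_special f <-> extrinsic_sphere f).
Proof.
have vs_sp : very_special f -> special f.
  by move=> vs i j x Ux; apply: very_special_special; exact: vs.
have sp_es : special f -> extrinsic_sphere f.
  by move=> sp; split=> // i j x Ux; apply: local_special_parallel => //; exact: sp.
have es_vs : extrinsic_sphere f -> very_special f.
  by move=> [_ par] i j x Ux; apply: local_parallel_very_special => //; exact: par.
by split; split => // h; [exact/es_vs/sp_es | exact/sp_es/vs_sp].
Qed.
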